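(* Let $\mathcal{M} = (E,\mathcal{C}^* )$ be a uniform matroid polytope of rank $4$. Then there exists a subset $F \subset E$ such that the reorientation ${}_{-F}\mathcal{M}$ is acyclic and has exactly $4$ extreme points (or equivalently, exactly $4$ facets).
   Context: **Oriented matroids.** Sign vectors on a finite set $E$ are elements $X \in \{+1,-1,0\}^E$; write $X^{+}, X^{-}, X^0$ for the sets of $e \in E$ with $X_e = +1$, $-1$, $0$ respectively. An oriented matroid is a pair $\mathcal{M} = (E,\mathcal{C}^* )$ with $E$ finite and $\mathcal{C}^* \subset \{+1,-1,0\}^E$ (its set of cocircuits) satisfying the standard signed cocircuit axioms: (C0) $0 \notin \mathcal{C}^*$; (C1) $\mathcal{C}^* = -\mathcal{C}^*$; (C2) if $X,Y \in \mathcal{C}^*$ and $X^0 \subset Y^0$, then $X = Y$ or $X = -Y$; (C3) if $X,Y \in \mathcal{C}^*$, $X \neq -Y$, and $X_e = -Y_e \neq 0$, then there is $Z \in \mathcal{C}^*$ with $e \in Z^0$, $Z^+ \subset X^+ \cup Y^+$ and $Z^- \subset X^- \cup Y^-$. For sign vectors, $(X \circ Y)_e = X_e$ if $X_e \neq 0$, and $(X\circ Y)_e = Y_e$ otherwise. The covectors of $\mathcal{M}$ are $0$ and all compositions $X_1 \circ \cdots \circ X_k$ with $k \geq 1$ and $X_i \in \mathcal{C}^*$. For covectors put $X \geq Y$ iff for every $e \in E$, $X_e = Y_e$ or $Y_e = 0$. The rank of $\mathcal{M}$ is the length $r$ of a maximal chain $0 < X_1 < \cdots < X_r$ of covectors.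 An oriented matroid of rank $r$ is uniform if its underlying matroid is uniform, i.e. $\{X^0 \mid X \in \mathcal{C}^*\}$ is the set of all $(r-1)$-element subsets of $E$. $\mathcal{M}$ is acyclic if the all-positive vector is a covector. A set $F \subset E$ is a face of $\mathcal{M}$ if there is a covector $X_F$ with $X_F^0 = F$ and $X_F^+ = E \setminus F$. An extreme point (resp. facet) is a face whose rank in the underlying matroid is $1$ (resp. $r-1$, where $r$ is the rank of $\mathcal{M}$); in a uniform oriented matroid of rank $4$ these are the faces with exactly one element (resp. exactly three elements). $\mathcal{M}$ is a matroid polytope if $\{e\}$ is an extreme point of $\mathcal{M}$ for every $e \in E$. **Reorientation.** For $F \subset E$, the reorientation ${}_{-F}\mathcal{M}$ is the oriented matroid on $E$ whose cocircuits are obtained from the cocircuits $X$ of $\mathcal{M}$ by reversing the sign $X_e$ for each $e \in F$ (and leaving $X_e$ unchanged for $e \notin F$). *)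

(* Defs.v *)
From HB Require Import structures.
From mathcomp Require Import all_boot all_order all_algebra.

Set Implicit Arguments.
Unset Strict Implicit.
Unset Printing Implicit Defensive.

Import GRing.Theory.
Local Open Scope ring_scope.

(* The signs +1, -1, 0 are the three elements 1, -1, 0 of 'Z_3.  Only negation
   is used from the ring structure, never addition or multiplication. *)
Definition sign_vector (E : finType) := {ffun E -> 'Z_3}.

Section SignVectors.
Variable E : finType.
Implicit Types (X Y : sign_vector E) (F : {set E}).

Definition pos_part X : {set E} := [set e | X e == 1].
Definition neg_part X : {set E} := [set e | X e == -1].
Definition zero_part X : {set E} := [set e | X e == 0].

Definition sv_comp X Y : sign_vector E :=
  [ffun e => if X e != 0 then X e else Y e].

Definition sv_ge X Y : bool := [forall e, (X e == Y e) || (Y e == 0)].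

Definition sv_reorient F X : sign_vector E :=
  [ffun e => if e \in F then - X e else X e].

End SignVectors.

Record oriented_matroid (E : finType) := OrientedMatroid {
  cocircuits : {set sign_vector E};
  cocircuit0 : 0 \notin cocircuits;
  cocircuitN : forall X, (- X \in cocircuits) = (X \in cocircuits);
  cocircuit_incomparable : forall X Y,
    X \in cocircuits -> Y \in cocircuits ->
    zero_part X \subset zero_part Y -> X = Y \/ X = - Y;
  cocircuit_elimination : forall X Y e,
    X \in cocircuits -> Y \in cocircuits ->
    X <> - Y -> X e = - Y e -> X e <> 0 ->
    exists Z, [/\ Z \in cocircuits, e \in zero_part Z,
      pos_part Z \subset pos_part X :|: pos_part Y &
      neg_part Z \subset neg_part X :|: neg_part Y]
}.

Section OrientedMatroids.
Variables (E : finType) (M : oriented_matroid E).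
Implicit Types (X Y : sign_vector E) (A F I : {set E}).

(* Reachability from 0 by composing with a cocircuit on the left; [covectorP]
   below shows that this describes 0 and the compositions X_1 o ... o X_k. *)
Definition covector X : bool :=
  connect [rel Y Z | [exists C in cocircuits M, Z == sv_comp C Y]] 0 X.

(* [foldr] adds a final factor 0, which is neutral, and gives 0 for k = 0. *)
Lemma covectorP X :
  reflect (exists2 s : seq (sign_vector E),
             {subset s <= cocircuits M} & X = foldr (@sv_comp E) 0 s)
          (covector X).
Proof.
apply: (iffP idP) => [/connectP[p]|[s + ->]].
  suff H Y : (exists2 s : seq (sign_vector E),
      {subset s <= cocircuits M} & Y = foldr (@sv_comp E) 0 s) ->
      path [rel Y Z | [exists C in cocircuits M, Z == sv_comp C Y]] Y p ->
      X = last Y p ->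
      exists2 s : seq (sign_vector E),
        {subset s <= cocircuits M} & X = foldr (@sv_comp E) 0 s.
    by apply: H; exists [::].
  elim: p Y => [|Z p IHp] Y [s sM Ys] /=; first by move=> _ ->; exists s.
  case/andP=> /existsP[C /andP[CM /eqP ZE]] pp XE.
  apply: IHp pp XE; exists (C :: s) => /=; last by rewrite ZE Ys.
  by move=> D; rewrite inE => /predU1P[->|/sM].
elim: s => [|C s IHs] sM /=; first exact: connect0.
apply: connect_trans (IHs _) (connect1 _).
  by move=> D Ds; apply: sM; rewrite inE Ds orbT.
by apply/existsP; exists C; rewrite sM ?mem_head //= eqxx.
Qed.

(* A chain 0 < X_1 < ... < X_r is encoded as the set {X_1, ..., X_r}.  All
   maximal chains have the same length, so the rank is the maximum length. *)
Definition covector_chain (S : {set sign_vector E}) : bool :=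
  [forall X in S, covector X && (X != 0)] &&
  [forall X in S, forall Y in S, sv_ge X Y || sv_ge Y X].

Definition om_rank : nat :=
  \max_(S : {set sign_vector E} | covector_chain S) #|S|.

(* The hyperplanes of the underlying matroid are the zero sets of cocircuits,
   and the closure of A is the intersection of the hyperplanes containing A. *)
Definition matroid_closure A : {set E} :=
  \bigcap_(X in cocircuits M | A \subset zero_part X) zero_part X.

Definition matroid_independent I : bool :=
  [forall e in I, e \notin matroid_closure (I :\ e)].

Definition matroid_rank A : nat :=
  \max_(I : {set E} | (I \subset A) && matroid_independent I) #|I|.

(* [#|A|.+1 == om_rank] rather than [#|A| == om_rank.-1], which is wrong in
   rank 0. *)
Definition om_uniform : Prop :=
  [set zero_part X | X in cocircuits M] =
  [set A : {set E} | #|A|.+1 == om_rank].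

Definition acyclic : bool := covector [ffun => 1].

Definition face F : bool :=
  [exists X, [&& covector X, zero_part X == F & pos_part X == ~: F]].

Definition extreme_point F : bool := face F && (matroid_rank F == 1%N).

Definition facet F : bool := face F && ((matroid_rank F).+1 == om_rank).

Definition matroid_polytope : Prop := forall e : E, extreme_point [set e].

End OrientedMatroids.

Section Reorientation.
Variables (E : finType) (F : {set E}).
Implicit Types X Y : sign_vector E.

Local Notation rF := (@sv_reorient E F).

Lemma sv_reorientK : involutive rF.
Proof. by move=> X; apply/ffunP=> e; rewrite !ffunE; case: (e \in F); rewrite ?opprK. Qed.

Lemma sv_reorientN X : rF (- X) = - rF X.
Proof. by apply/ffunP=> e; rewrite !ffunE; case: (e \in F). Qed.

Lemma zero_part_reorient X : zero_part (rF X) = zero_part X.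
Proof. by apply/setP=> e; rewrite !inE ffunE; case: (e \in F); rewrite ?oppr_eq0. Qed.

Variable M : oriented_matroid E.

Definition reorient_cocircuits : {set sign_vector E} := rF @: cocircuits M.

Lemma mem_reorient_cocircuits X :
  (X \in reorient_cocircuits) = (rF X \in cocircuits M).
Proof. by rewrite -{1}(sv_reorientK X) mem_imset //; apply: inv_inj sv_reorientK. Qed.

Fact reorient_cocircuit0 : 0 \notin reorient_cocircuits.
Proof.
rewrite mem_reorient_cocircuits.
suff -> : rF 0 = 0 by exact: cocircuit0.
by apply/ffunP=> e; rewrite !ffunE oppr0 if_same.
Qed.

Fact reorient_cocircuitN X :
  (- X \in reorient_cocircuits) = (X \in reorient_cocircuits).
Proof. by rewrite !mem_reorient_cocircuits sv_reorientN cocircuitN. Qed.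

Fact reorient_cocircuit_incomparable X Y :
  X \in reorient_cocircuits -> Y \in reorient_cocircuits ->
  zero_part X \subset zero_part Y -> X = Y \/ X = - Y.
Proof.
rewrite !mem_reorient_cocircuits => XM YM.
rewrite -(zero_part_reorient X) -(zero_part_reorient Y) => XY.
have [/(inv_inj sv_reorientK)|] := cocircuit_incomparable XM YM XY; first by left.
by rewrite -sv_reorientN => /(inv_inj sv_reorientK); right.
Qed.

Fact reorient_cocircuit_elimination X Y e :
  X \in reorient_cocircuits -> Y \in reorient_cocircuits ->
  X <> - Y -> X e = - Y e -> X e <> 0 ->
  exists Z, [/\ Z \in reorient_cocircuits, e \in zero_part Z,
    pos_part Z \subset pos_part X :|: pos_part Y &
    neg_part Z \subset neg_part X :|: neg_part Y].
Proof.
rewrite !mem_reorient_cocircuits => XM YM XY Xe Xe0.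
have [|||Z [ZM Ze Zp Zn]] := @cocircuit_elimination _ M _ _ e XM YM.
- by rewrite -sv_reorientN => /(inv_inj sv_reorientK).
- by rewrite !ffunE Xe; case: ifP.
- by rewrite ffunE; case: ifP => // _ /eqP; rewrite oppr_eq0 => /eqP.
exists (rF Z); rewrite mem_reorient_cocircuits sv_reorientK zero_part_reorient.
split=> //; apply/subsetP=> f; move/subsetP/(_ f): Zp; move/subsetP/(_ f): Zn;
  rewrite !inE !ffunE; case: ifP => // _; rewrite ?eqr_opp //.
- by rewrite !eqr_oppLR => + _.
- by rewrite !eqr_oppLR => _ +.
Qed.

Definition reorientation : oriented_matroid E :=
  OrientedMatroid reorient_cocircuit0 reorient_cocircuitN
    reorient_cocircuit_incomparable reorient_cocircuit_elimination.

End Reorientation.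

(* Main.v *)
(* Call a cocircuit a vertex and think of the elements as points, so that a
   vertex is a plane spanned by three points.  A reorientation is a simplex as
   soon as some vertex [xyz] and some point [v] satisfy: on each of the lines
   [xy], [xz], [yz] of the dual arrangement no element is crossed between [v]
   and [xyz].

   Take an edge [va] of a facet and sweep from [v] to [a] through the vertices
   separating [v] from [a].  If no vertex were first on its three lines, some
   nonempty set [S] of separating vertices would be closed under moving back
   towards [v] along a line; take [S] minimal.  The elements spanning the
   members of [S] are ordered by angle around the edge [va].  In convex
   position every five points split 2 + 3 by Radon, hence the plane of either
   angularly extreme element [o] is crossed by all lines in the same direction.
   The sign at [o] is then monotone along moves, so by minimality it is
   constant on [S], hence 0.  With two extremes [o] and [m], all of [S] lies
   on the line [om], where moving back must terminate.

   Four extreme points versus four facets: dropping a point of a facet, one can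
   pivot to another facet through the remaining two points. *)
Require Import Defs.
From mathcomp Require Import all_boot all_order all_algebra.
From mathcomp Require Import zify.
Set Implicit Arguments.
Unset Strict Implicit.
Unset Printing Implicit Defensive.
Import GRing.Theory Num.Theory Order.TTheory.
Local Open Scope ring_scope.

(** * Preliminaries on distinctness, finite subsets and signs *)

Ltac split_uniq u :=
  move: u; rewrite /= ?inE ?negb_or -?andbA;
  repeat (let H := fresh "neq" in case/andP => H); move=> ?.

Ltac solve_uniq :=
  rewrite /= ?inE ?negb_or;
  repeat (apply/andP; split); try done; rewrite eq_sym; done.

Lemma subset_of_card (T : finType) (A B : {set T}) k : A \subset B ->
  (#|A| <= k <= #|B|)%N -> exists H : {set T}, [/\ A \subset H, H \subset B & #|H| = k].
Proof.
move=> AB /andP[Ak kB]; exists (A :|: [set x in take (k - #|A|) (enum (B :\: A))]).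
split; first exact: subsetUl.
  rewrite subUset AB /=; apply/subsetP=> x; rewrite inE => /mem_take.
  by rewrite mem_enum inE => /andP[].
rewrite cardsU disjoint_setI0 ?cards0; last first.
  rewrite -setI_eq0; apply/eqP/setP=> x; rewrite !inE; apply/andP=> -[xA /mem_take].
  by rewrite mem_enum inE xA.
rewrite subn0 cardsE (card_uniqP _) ?take_uniq ?enum_uniq // size_take_min -cardE.
have := cardsD B A; rewrite (setIidPr AB); lia.
Qed.

Section Signs.
Variable E : finType.
Implicit Types X Y : sign_vector E.

(* Integer-valued signs: sign conditions become inequalities, which [lia]
   decides. *)
Definition sg X e : int := if X e == 0 then 0 else if X e == 1 then 1 else -1.

Lemma sign_cases (s : 'Z_3) : [\/ s = 0, s = 1 | s = -1].
Proof.
case: s => [[|[|[|//]]] i]; [exact/Or31/val_inj|exact/Or32/val_inj|].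
exact/Or33/val_inj.
Qed.

Lemma sg_eq0 X e : (sg X e == 0) = (X e == 0).
Proof. by rewrite /sg; case: (sign_cases (X e)) => ->. Qed.

Lemma sg_gt0 X e : (0 < sg X e) = (X e == 1).
Proof. by rewrite /sg; case: (sign_cases (X e)) => ->. Qed.

Lemma sg_lt0 X e : (sg X e < 0) = (X e == -1).
Proof. by rewrite /sg; case: (sign_cases (X e)) => ->. Qed.

Lemma sgN X e : sg (- X) e = - sg X e.
Proof. by rewrite /sg !ffunE; case: (sign_cases (X e)) => ->. Qed.

Lemma sg_neq X e f : sg X e <> sg X f -> e != f.
Proof. by move=> Xef; apply/eqP=> ef; rewrite ef in Xef. Qed.

End Signs.

(* [lia] sees only the sign hypotheses: preprocessing the membership ones is
   very slow. *)
Ltac sgn :=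
  repeat match goal with H : ?P |- _ =>
    lazymatch type of P with Prop =>
      lazymatch P with
      | forall _, _ => clear H
      | context [sg] => fail
      | _ => clear H
      end
    end
  end; lia.

(** * Elimination and pivoting in uniform oriented matroids of rank 4 *)

Section Uniform4.
Variables (E : finType) (M : oriented_matroid E).
Hypothesis uniform4 :
  [set zero_part X | X in cocircuits M] = [set A : {set E} | #|A| == 3%N].
Implicit Types A C D K P X Y Z : sign_vector E.

Lemma card_zero_part X : X \in cocircuits M -> #|zero_part X| = 3%N.
Proof.
move=> XM; have: zero_part X \in [set zero_part X | X in cocircuits M].
  exact: imset_f.
by rewrite uniform4 inE => /eqP.
Qed.

Lemma opp_cocircuit X : X \in cocircuits M -> - X \in cocircuits M.
Proof. by rewrite cocircuitN. Qed.

Lemma zero_partE X x y z : X \in cocircuits M -> uniq [:: x; y; z] ->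
  sg X x = 0 -> sg X y = 0 -> sg X z = 0 -> zero_part X = [set x; y; z].
Proof.
move=> XM u /eqP + /eqP + /eqP; rewrite !sg_eq0 => X1 X2 X3.
apply/esym/eqP; rewrite eqEcard card_zero_part //.
apply/andP; split.
  by apply/subsetP=> t; rewrite !inE => /orP[/orP[]|] /eqP->.
have -> : [set x; y; z] = [set t in [:: x; y; z]].
  by apply/setP=> t; rewrite !inE orbA.
by rewrite cardsE (card_uniqP u).
Qed.

Lemma vanish3 X x y z t : X \in cocircuits M -> uniq [:: x; y; z] ->
  sg X x = 0 -> sg X y = 0 -> sg X z = 0 -> sg X t = 0 ->
  [\/ t = x, t = y | t = z].
Proof.
move=> XM u X1 X2 X3 /eqP Xt; have: t \in zero_part X by rewrite inE -sg_eq0.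
rewrite (zero_partE XM u X1 X2 X3) !inE => /orP[/orP[]|] /eqP ->;
  [exact: Or31|exact: Or32|exact: Or33].
Qed.

Lemma cocircuit_through x y z f : uniq [:: x; y; z; f] ->
  exists X, [/\ X \in cocircuits M, sg X x = 0, sg X y = 0, sg X z = 0 &
                0 < sg X f].
Proof.
move=> u; have u3 : uniq [:: x; y; z].
  by move: u; rewrite (cat_uniq [:: x; y; z]) => /andP[].
have: [set x; y; z] \in [set A : {set E} | #|A| == 3%N].
  rewrite inE; have -> : [set x; y; z] = [set t in [:: x; y; z]].
    by apply/setP=> t; rewrite !inE orbA.
  by rewrite cardsE (card_uniqP _).
rewrite -uniform4 => /imsetP[X XM XE].
have X0 t : t \in [set x; y; z] -> sg X t = 0.
  by rewrite XE inE -sg_eq0 => /eqP.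
have [X1 X2 X3] : [/\ sg X x = 0, sg X y = 0 & sg X z = 0].
  by split; apply/X0; rewrite !inE eqxx ?orbT.
have [Xf|Xf|/(vanish3 XM u3 X1 X2 X3) fE] := ltrgtP (sg X f) 0.
- by exists (- X); rewrite opp_cocircuit // !sgN; split; sgn.
- by exists X.
- exfalso; move: u; rewrite (cat_uniq [:: x; y; z] [:: f]) /= !inE orbF.
  by case: fE => ->; rewrite eqxx ?orbT !andbF.
Qed.

Lemma cocircuit_eq X Y x y z f : X \in cocircuits M -> Y \in cocircuits M ->
  uniq [:: x; y; z] -> sg X x = 0 -> sg X y = 0 -> sg X z = 0 ->
  sg Y x = 0 -> sg Y y = 0 -> sg Y z = 0 -> 0 < sg X f -> 0 < sg Y f -> X = Y.
Proof.
move=> XM YM u X1 X2 X3 Y1 Y2 Y3 Xf Yf.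
have [|//|XY] := cocircuit_incomparable XM YM.
  by rewrite (zero_partE XM u) // (zero_partE YM u).
by move: Xf; rewrite XY sgN; sgn.
Qed.

(** (C3) as a trichotomy at every element: common zeros persist, and where one of [X], [Y] vanishes
    the other fixes the sign up to 0, a case that [cocircuit_neq0] usually excludes. *)
Lemma eliminate X Y e : X \in cocircuits M -> Y \in cocircuits M ->
  X <> - Y -> 0 < sg X e -> sg Y e < 0 ->
  exists Z, [/\ Z \in cocircuits M, sg Z e = 0 &
    forall f, [\/ sg Z f = 0, sg Z f = sg X f | sg Z f = sg Y f]].
Proof.
move=> XM YM XY; rewrite sg_gt0 sg_lt0 => /eqP Xe /eqP Ye.
have [||Z [ZM]] := cocircuit_elimination (e := e) XM YM XY.
- by rewrite Xe Ye opprK.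
- by rewrite Xe.
rewrite inE => Ze /subsetP Zp /subsetP Zn.
exists Z; split=> // [|f]; first by apply/eqP; rewrite sg_eq0.
rewrite /sg; case: (sign_cases (Z f)) => Zf; first by rewrite Zf; apply: Or31.
- by have := Zp f; rewrite !inE Zf eqxx => /(_ isT)/orP[]/eqP->;
    [exact: Or32|exact: Or33].
- by have := Zn f; rewrite !inE Zf eqxx => /(_ isT)/orP[]/eqP->;
    [exact: Or32|exact: Or33].
Qed.

Lemma eliminateN X Y e : X \in cocircuits M -> Y \in cocircuits M ->
  X <> Y -> 0 < sg X e -> 0 < sg Y e ->
  exists Z, [/\ Z \in cocircuits M, sg Z e = 0 &
    forall f, [\/ sg Z f = 0, sg Z f = sg X f | sg Z f = - sg Y f]].
Proof.
move=> XM YM XY Xe Ye.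
have [|||Z [ZM Ze Zc]] := eliminate (e := e) XM (opp_cocircuit YM).
- by rewrite opprK.
- exact: Xe.
- by rewrite sgN; sgn.
by exists Z; split=> // f; have := Zc f; rewrite sgN.
Qed.

(** The cocircuits [C] place [e] inside the simplex spanned by [B]. If [Z] failed at [e],
    eliminating some [b] between [Z] and [- C] would give another failure with fewer nonzero signs
    on [B]; but no cocircuit vanishes on four elements. *)
Lemma simplex_interior (B : seq E) e Z : uniq B -> size B = 4%N ->
  (forall b, b \in B -> exists C, [/\ C \in cocircuits M, 0 < sg C b,
     0 < sg C e & forall c, c \in B -> c <> b -> sg C c = 0]) ->
  Z \in cocircuits M -> (forall b, b \in B -> 0 <= sg Z b) -> 0 < sg Z e.
Proof.
move=> uB sB simB.
have [m] := ubnP #|[set b in B | sg Z b != 0]|.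
elim: m Z => // m IHm Z le_m ZM Z0.
have [//|Ze] := boolP (0 < sg Z e).
have [/hasP[b bB Zb]|noZ] := boolP (has (fun b => sg Z b != 0) B); last first.
  have BZ : {subset B <= enum (zero_part Z)}.
    move=> b bB; move/hasPn/(_ b bB): noZ.
    by rewrite negbK mem_enum inE sg_eq0.
  by have := uniq_leq_size uB BZ; rewrite sB -cardE card_zero_part.
have [C [CM Cb Ce C0]] := simB b bB.
have Zb1 : 0 < sg Z b by have := Z0 b bB; sgn.
have [|Z' [Z'M Z'b Z'c]] := eliminateN ZM CM _ Zb1 Cb.
  by move=> ZC; rewrite ZC Ce in Ze.
have Z'B c : c \in B -> sg Z' c = 0 \/ sg Z' c = sg Z c.
  move=> cB; have [->|/eqP cb] := eqVneq c b; first by left.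
  by have := C0 c cB cb; have [] := Z'c c; sgn.
suff: 0 < sg Z' e by have [] := Z'c e; sgn.
apply: IHm => //; last first.
  by move=> c cB; have := Z0 c cB; have [->|->] := Z'B c cB.
move: le_m; rewrite ltnS; apply/leq_trans/proper_card/properP; split.
  apply/subsetP=> c; rewrite !inE => /andP[cB]; rewrite cB /=.
  by case: (Z'B c cB) => ->.
by exists b; rewrite !inE bB ?Z'b ?eqxx.
Qed.

Lemma cocircuit_neq0 X x y z t : X \in cocircuits M -> uniq [:: x; y; z; t] ->
  sg X x = 0 -> sg X y = 0 -> sg X z = 0 -> sg X t != 0.
Proof.
move=> XM u X1 X2 X3; split_uniq u.
have u3 : uniq [:: x; y; z] by solve_uniq.
by apply/eqP => /(vanish3 XM u3 X1 X2 X3)[] tE; subst t; rewrite eqxx in neq1 neq3 neq4.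
Qed.

(** Rotation of the plane [K] about the line [pq] up to the last element of [L]. A candidate [D]
    that is negative at some [t] in [L] is replaced by its elimination with [K] at [t], which has
    fewer negative elements in [L]. *)
Lemma pivot K p q z (L : {set E}) : K \in cocircuits M ->
  uniq [:: p; q; z] -> sg K p = 0 -> sg K q = 0 -> sg K z = 0 ->
  (forall f, f \in L -> 0 <= sg K f) -> p \notin L -> q \notin L ->
  (exists2 w, w \in L & w != z) ->
  exists w D, [/\ w \in L, D \in cocircuits M,
    [/\ sg D p = 0, sg D q = 0 & sg D w = 0], 0 < sg D z &
    forall f, f \in L -> 0 <= sg D f].
Proof.
move=> KM u Kp Kq Kz K0 pL qL [w wL wz].
have inL t : t \in L -> (p != t) && (q != t).
  by move=> tL; rewrite !(eq_sym _ t) !(memPn _ t tL).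
split_uniq u; have /andP[pw qw] := inL w wL.
have [|D [DM Dp Dq Dw Dz]] := @cocircuit_through p q w z; first by solve_uniq.
have [m] := ubnP #|[set f in L | sg D f < 0]|.
elim: m w D {wz pw qw} wL DM Dp Dq Dw Dz => // m IHm w D wL DM Dp Dq Dw Dz le_m.
have [/exists_inP[t tL Dt]|] := boolP [exists f in L, sg D f < 0]; last first.
  rewrite negb_exists_in => /forall_inP D0.
  by exists w, D; split=> // f /D0; rewrite -leNgt.
have /andP[pt qt] := inL t tL.
have zt : z != t by apply/eqP=> zt; rewrite zt in Dz; sgn.
have Kt : 0 < sg K t.
  rewrite lt_neqAle K0 // andbT eq_sym.
  by apply: (@cocircuit_neq0 K p q z) => //; solve_uniq.
have [|Z [ZM Zt Zc]] := eliminate KM DM _ Kt Dt.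
  by move=> KD; move: Kz; rewrite KD sgN; sgn.
have Zp : sg Z p = 0 by case: (Zc p); sgn.
have Zq : sg Z q = 0 by case: (Zc q); sgn.
apply: (IHm t Z) => //.
  have : sg Z z != 0 by apply: (@cocircuit_neq0 Z p q t) => //; solve_uniq.
  by case: (Zc z); sgn.
move: le_m; rewrite ltnS; apply/leq_trans/proper_card/properP; split.
  apply/subsetP=> c; rewrite !inE => /andP[cL Zc0]; rewrite cL /=.
  by have := K0 c cL; case: (Zc c); sgn.
by exists t; rewrite !inE tL ?Dt // Zt ltxx.
Qed.

(** * Convex position and planes around an edge *)

Section Polytope.
Hypothesis polytope : forall e, exists K,
  [/\ K \in cocircuits M, sg K e = 0 & forall f, 0 <= sg K f].

(** By [D] and [C], [x] lies between [o] and [y] in the angular order around [va]. The planes [S],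
    [R], [C], [D] built below place [x] inside the simplex [vaoy], although some nonnegative
    cocircuit vanishes at [x]. *)
Lemma one_way_crossing_middle v a o x y D C A P : uniq [:: v; a; o; x; y] ->
  D \in cocircuits M -> C \in cocircuits M ->
  A \in cocircuits M -> P \in cocircuits M ->
  [/\ sg D v = 0, sg D a = 0, sg D o = 0, 0 < sg D x & 0 < sg D y] ->
  [/\ sg C v = 0, sg C a = 0, sg C y = 0, 0 < sg C o & 0 < sg C x] ->
  [/\ sg A v = 0, sg A x = 0, sg A y = 0, 0 < sg A a & sg A o < 0] ->
  [/\ sg P x = 0, sg P y = 0, sg P v < 0, 0 < sg P a & 0 <= sg P o] -> False.
Proof.
move=> u DM CM AM PM [D1 D2 D3 D4 D5] [C1 C2 C3 C4 C5] [A1 A2 A3 A4 A5].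
move=> [P1 P2 P3 P4 P5]; split_uniq u.
(* The plane [xyo] separates [v] from [a] just as [P] does. *)
have [Q [QM [Q1 Q2 Q3 Q4 Q5]]] : exists Q, Q \in cocircuits M /\
    [/\ sg Q x = 0, sg Q y = 0, sg Q o = 0, sg Q v < 0 & 0 < sg Q a].
  have [Po|Po] := eqVneq (sg P o) 0; first by exists P.
  have [||Z [ZM Zo Zc]] := eliminate (e := o) PM AM _ _ A5; last first.
  - have [Zx Zy] : sg Z x = 0 /\ sg Z y = 0.
      by split; [case: (Zc x)|case: (Zc y)]; sgn.
    have Zv : sg Z v != 0 by apply: (@cocircuit_neq0 Z x y o) => //; solve_uniq.
    have Za : sg Z a != 0 by apply: (@cocircuit_neq0 Z x y o) => //; solve_uniq.
    by exists Z; split=> //; split=> //; [case: (Zc v)|case: (Zc a)]; sgn.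
  - by sgn.
  - by move=> PA; move: P4; rewrite PA sgN; sgn.
have [|R [RM Ro Rc]] := eliminate CM AM _ C4 A5.
  by move=> CA; move: C2; rewrite CA sgN; sgn.
have [Rv Ry] : sg R v = 0 /\ sg R y = 0.
  by split; [case: (Rc v)|case: (Rc y)]; sgn.
have Ra : 0 < sg R a.
  have : sg R a != 0 by apply: (@cocircuit_neq0 R v y o) => //; solve_uniq.
  by case: (Rc a); sgn.
have Rx : 0 < sg R x.
  have : sg R x != 0 by apply: (@cocircuit_neq0 R v y o) => //; solve_uniq.
  by case: (Rc x); sgn.
have [|S [SM Sa Sc]] := eliminateN RM QM _ Ra Q5.
  by move=> RQ; move: Rv; rewrite RQ; sgn.
have [So Sy] : sg S o = 0 /\ sg S y = 0.
  by split; [case: (Sc o)|case: (Sc y)]; sgn.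
have Sv : 0 < sg S v.
  have : sg S v != 0 by apply: (@cocircuit_neq0 S a o y) => //; solve_uniq.
  by case: (Sc v); sgn.
have Sx : 0 < sg S x.
  have : sg S x != 0 by apply: (@cocircuit_neq0 S a o y) => //; solve_uniq.
  by case: (Sc x); sgn.
have [K [KM Kx K0]] := polytope x.
suff : 0 < sg K x by rewrite Kx.
apply: (@simplex_interior [:: v; a; o; y]) => //; first by solve_uniq.
by move=> b; rewrite !inE => /or4P[]/eqP->; [exists S|exists R|exists C|exists D];
  split=> // c; rewrite !inE => /or4P[]/eqP->.
Qed.

(* In convex position a point in the middle of the angular order around the
   edge [va] cannot lie inside the simplex spanned by [v], [a] and the two
   extremes, so a line sweeping from [v] towards [a] crosses the plane of an
   angularly extreme [o] only from the positive to the negative side. *)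
Lemma one_way_crossing v a o x y D A P : uniq [:: v; a; o; x; y] ->
  D \in cocircuits M -> A \in cocircuits M -> P \in cocircuits M ->
  [/\ sg D v = 0, sg D a = 0, sg D o = 0, 0 < sg D x & 0 < sg D y] ->
  [/\ sg A v = 0, sg A x = 0, sg A y = 0, 0 < sg A a & sg A o < 0] ->
  [/\ sg P x = 0, sg P y = 0, sg P v < 0 & 0 < sg P a] -> sg P o < 0.
Proof.
move=> u DM AM PM [D1 D2 D3 D4 D5] [A1 A2 A3 A4 A5] [P1 P2 P3 P4].
rewrite ltNge; apply/negP=> P5; have u' := u; split_uniq u'.
have [|C [CM C1 C2 C3 C4]] := @cocircuit_through v a y o; first by solve_uniq.
have Cx : sg C x != 0 by apply: (@cocircuit_neq0 C v a y) => //; solve_uniq.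
have [Cx0|Cx0] := ltP 0 (sg C x).
  by apply: (@one_way_crossing_middle v a o x y D C A P).
(* Otherwise [y] is the middle element: the plane [S] through [v], [a], [x] is positive at [o] and
   [y], so [x] and [y] exchange roles. *)
have [||S [SM Sx Sc]] := eliminate (e := x) DM CM _ D4; last first.
- have [Sv Sa] : sg S v = 0 /\ sg S a = 0.
    by split; [case: (Sc v)|case: (Sc a)]; sgn.
  have So : sg S o != 0 by apply: (@cocircuit_neq0 S v a x) => //; solve_uniq.
  have Sy : sg S y != 0 by apply: (@cocircuit_neq0 S v a x) => //; solve_uniq.
  apply: (@one_way_crossing_middle v a o y x D S A P) => //; first by solve_uniq.
  by split=> //; [case: (Sc o)|case: (Sc y)]; sgn.
- by sgn.
- by move=> DC; move: D5; rewrite DC sgN; sgn.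
Qed.

(** * The sweep along an edge *)

Section EdgeSweep.
Variables (v a b : E) (K0 : sign_vector E).
Hypotheses (vab : uniq [:: v; a; b]) (K0M : K0 \in cocircuits M).
Hypotheses (K0v : sg K0 v = 0) (K0a : sg K0 a = 0) (K0b : sg K0 b = 0).
Hypothesis K0_ge0 : forall f, 0 <= sg K0 f.
Implicit Types (S : {set sign_vector E}) (L : {set E}) (e f o x y : E).

Definition separates P := [&& P \in cocircuits M, sg P v < 0 & 0 < sg P a].

(* [A] is the point of the line through [x] and [y] lying on [v]. *)
Definition initial A x y := [&& A \in cocircuits M, sg A v == 0, sg A x == 0,
  sg A y == 0 & 0 < sg A a].

(* [Q] precedes [P] on the line through [x] and [y], swept from its
   intersection [A] with [v]. *)
Definition step Q P := exists x y A e,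
  [/\ x != y, initial A x y, [/\ sg P x = 0, sg P y = 0, sg Q x = 0 & sg Q y = 0],
      [/\ sg P e = - sg A e, sg P e != 0 & sg Q e = 0] &
      forall f, [\/ sg Q f = 0, sg Q f = sg P f | sg Q f = sg A f]].

(** On the line [xy], the element [e] is crossed strictly between [v] and [P]. *)
Definition blocked P := [exists x, exists y, exists A, exists e,
  [&& x != y, initial A x y, sg P x == 0, sg P y == 0, sg P e != 0 &
      sg P e == - sg A e]].

(** [Q] is where the line [xy] meets [e]. Its zeros [x], [y], [e] differ from [v] and [a], so its
    signs there come from [P] and [A]. *)
Lemma blocked_step P : separates P -> blocked P ->
  exists2 Q, separates Q & step Q P.
Proof.
case/and3P=> PM Pv Pa /existsP[x] /existsP[y] /existsP[A] /existsP[e].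
case/and5P=> xy Axy /eqP Px /eqP Py /andP[Pe /eqP PAe].
have /and5P[AM /eqP Av /eqP Ax /eqP Ay Aa] := Axy.
have [Q [QM Qe Qc]] : exists Q, [/\ Q \in cocircuits M, sg Q e = 0 &
    forall f, [\/ sg Q f = 0, sg Q f = sg P f | sg Q f = sg A f]].
  have PA : P <> - A by move=> PA; move: Pa; rewrite PA sgN; sgn.
  have [Pe0|Pe0] := ltP 0 (sg P e).
    by apply: eliminate => //; sgn.
  have [|||Q [QM Qe Qc]] := @eliminate A P e AM PM; try sgn.
    by move=> AP; apply: PA; rewrite AP opprK.
  by exists Q; split=> // f; case: (Qc f); [exact: Or31|exact: Or33|exact: Or32].
have [Qx Qy] : sg Q x = 0 /\ sg Q y = 0.
  by split; [case: (Qc x)|case: (Qc y)]; sgn.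
have xe : x != e by apply: (@sg_neq _ P); sgn.
have ye : y != e by apply: (@sg_neq _ P); sgn.
have Q0 t : x != t -> y != t -> e != t -> sg Q t != 0.
  by move=> xt yt et; apply: (@cocircuit_neq0 Q x y e) => //; solve_uniq.
have Qv : sg Q v != 0.
  by apply: Q0; [apply: (@sg_neq _ P)|apply: (@sg_neq _ P)|apply: (@sg_neq _ A)]; sgn.
have Qa : sg Q a != 0.
  apply: Q0; [apply: (@sg_neq _ P)|apply: (@sg_neq _ P)|]; try sgn.
  by apply/eqP=> ea; rewrite ea in PAe Pe; sgn.
exists Q; first by apply/and3P; split=> //; [case: (Qc v)|case: (Qc a)]; sgn.
by exists x, y, A, e; split.
Qed.

(** Since [K0] is nonnegative, the angular order of [L] around [va] is linear. Pivoting [K0] about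
    [va] reaches one extreme [o]; pivoting again from [o] reaches the other, [m]. *)
Lemma two_ends L : v \notin L -> a \notin L ->
  (exists s t, [/\ s \in L, t \in L & s != t]) ->
  exists o m, [/\ o \in L, m \in L, o != m &
    forall i, i \in [:: o; m] -> exists D, [/\ D \in cocircuits M,
      sg D v = 0, sg D a = 0, sg D i = 0 & forall f, f \in L -> 0 <= sg D f]].
Proof.
move=> vL aL [s [t [sL tL st]]].
have avoid z : exists2 w, w \in L & w != z.
  by have [<-|] := eqVneq s z; [exists t; rewrite // eq_sym|exists s].
have K0L f : f \in L -> 0 <= sg K0 f by [].
have [o [D [oL DM [Dv Da Do] _ D0]]] :=
  pivot K0M vab K0v K0a K0b K0L vL aL (avoid b).
have vao : uniq [:: v; a; o].
  split_uniq vab; have /memPn/(_ _ oL) vo := vL; have /memPn/(_ _ oL) ao := aL.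
  by solve_uniq.
have [m [D' [mL D'M [D'v D'a D'm] D'o D'0]]] :=
  pivot DM vao Dv Da Do D0 vL aL (avoid o).
exists o, m; split=> //; first by apply: (@sg_neq _ D'); sgn.
by move=> i; rewrite !inE => /orP[]/eqP->; [exists D|exists D'].
Qed.

(** By [one_way_crossing], [0 <= sg P o] forces [0 <= sg A o], and [Q] takes its sign at [o] from
    [P] or [A] or vanishes. In the strict case [o] is none of the zeros [x], [y], [e] of [Q],
    because [P] and [A] have opposite signs at [e]. *)
Lemma step_end L o D P Q : v \notin L -> a \notin L -> o \in L ->
  (forall x, sg P x = 0 -> x \in L) ->
  D \in cocircuits M -> sg D v = 0 -> sg D a = 0 -> sg D o = 0 ->
  (forall f, f \in L -> 0 <= sg D f) ->
  separates P -> separates Q -> step Q P ->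
  (0 <= sg P o -> 0 <= sg Q o) /\ (0 < sg P o -> 0 < sg Q o).
Proof.
move=> vL aL oL PL DM Dv Da Do D0 /and3P[PM Pv Pa] /and3P[QM Qv Qa].
case=> x [y [A [e [xy]]]] /and5P[AM /eqP Av /eqP Ax /eqP Ay Aa].
case=> Px Py Qx Qy [PAe Pe Qe] Qc.
have neqL t : t \in L -> (v != t) && (a != t).
  by move=> tL; rewrite !(eq_sym _ t) (memPn vL) // (memPn aL).
have Ao : 0 <= sg P o -> 0 <= sg A o.
  apply: contraTT; rewrite -!ltNge => Ao; have xL := PL x Px; have yL := PL y Py.
  have [/andP[vo ao] /andP[vx ax] /andP[vy ay]] := And3 (neqL o oL) (neqL x xL) (neqL y yL).
  have ox : o != x by apply: (@sg_neq _ A); sgn.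
  have oy : o != y by apply: (@sg_neq _ A); sgn.
  have va : v != a by split_uniq vab.
  have Dpos t : t \in L -> o != t -> 0 < sg D t.
    move=> tL ot; have /andP[vt at_] := neqL t tL.
    rewrite lt_neqAle D0 // andbT eq_sym.
    by apply: (@cocircuit_neq0 D v a o) => //; solve_uniq.
  apply: (@one_way_crossing v a o x y D A P) => //; first by solve_uniq.
  by split=> //; apply: Dpos.
split=> [Po|Po]; have {}Ao := Ao; first by have := Ao Po; case: (Qc o); sgn.
have {}Ao : 0 <= sg A o by apply: Ao; sgn.
have : sg Q o != 0; last by case: (Qc o); sgn.
apply: (@cocircuit_neq0 Q x y e) => //.
have xe : x != e by apply: (@sg_neq _ P); sgn.
have ye : y != e by apply: (@sg_neq _ P); sgn.
have xo : x != o by apply: (@sg_neq _ P); sgn.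
have yo : y != o by apply: (@sg_neq _ P); sgn.
have eo : e != o by apply/eqP=> eo; rewrite eo in PAe; sgn.
by solve_uniq.
Qed.

Lemma three_zeros P : P \in cocircuits M -> exists x y z,
  [/\ uniq [:: x; y; z], sg P x = 0, sg P y = 0 & sg P z = 0].
Proof.
move=> PM; have := card_zero_part PM; have := enum_uniq (zero_part P).
have mem t : t \in enum (zero_part P) -> sg P t = 0.
  by rewrite mem_enum inE -sg_eq0 => /eqP.
rewrite cardE; case: (enum _) mem => [|x [|y [|z []]]] // mem u _.
by exists x, y, z; split=> //; apply: mem; rewrite !inE eqxx ?orbT.
Qed.

Lemma closed_under_step_empty S : (forall P, P \in S -> separates P) ->
  (forall P, P \in S -> exists2 Q, Q \in S & step Q P) -> S = set0.
Proof.
have [n] := ubnP #|S|; elim: n S => // n IHn S le_n sepS stepS.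
apply/eqP; apply: contraT => /set0Pn[P0 P0S].
(* A property preserved by moving back cannot single out a proper nonempty subset of [S]: that
   subset would be closed too, contradicting the induction hypothesis. *)
have all_or_none (R : pred (sign_vector E)) :
    (forall P Q, P \in S -> Q \in S -> step Q P -> R P -> R Q) ->
    forall P, P \in S -> R P -> forall Q, Q \in S -> R Q.
  move=> Rstep P PS RP Q QS; apply: contraT => nRQ.
  suff /setP/(_ P) : [set P in S | R P] = set0 by rewrite !inE PS RP.
  apply: IHn => [|P'|P'].
  - move: le_n; rewrite ltnS; apply/leq_trans/proper_card/properP; split.
      by apply/subsetP=> P'; rewrite inE => /andP[].
    by exists Q; rewrite ?inE ?QS.
  - by rewrite inE => /andP[/sepS].
  - rewrite inE => /andP[P'S RP']; have [Q' Q'S Q'P'] := stepS P' P'S.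
    by exists Q' => //; rewrite inE Q'S (Rstep P').
pose L := [set f | [exists P in S, sg P f == 0]].
have SL P f : P \in S -> sg P f = 0 -> f \in L.
  by move=> PS Pf; rewrite inE; apply/exists_inP; exists P; rewrite // Pf.
have vL : v \notin L.
  rewrite inE; apply/negP=> /exists_inP[P /sepS/and3P[_ Pv _] /eqP]; sgn.
have aL : a \notin L.
  rewrite inE; apply/negP=> /exists_inP[P /sepS/and3P[_ _ Pa] /eqP]; sgn.
have [|o [m [oL mL om ends]]] := two_ends vL aL.
  have /and3P[P0M _ _] := sepS P0 P0S.
  have [x [y [z [u Px Py Pz]]]] := three_zeros P0M; split_uniq u.
  by exists x, y; rewrite !(SL P0).
(* Some [Pi] in [S] vanishes at [i], so [0 <= sg P i] spreads to all of [S]. Were it strict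
   somewhere, it would be strict everywhere, even at [Pi]. *)
have end0 i P : i \in [:: o; m] -> P \in S -> sg P i = 0.
  move=> iom PS; have [D [DM Dv Da Di D0]] := ends i iom.
  have iL : i \in L by move: iom; rewrite mem_seq2 => /orP[]/eqP->.
  have stepi P' Q' (P'S : P' \in S) (Q'S : Q' \in S) :=
    step_end vL aL iL (SL P' ^~ P'S) DM Dv Da Di D0 (sepS P' P'S) (sepS Q' Q'S).
  have /exists_inP[Pi PiS /eqP Pi0] : [exists P in S, sg P i == 0] by rewrite inE in iL.
  have Pge0 : 0 <= sg P i.
    apply: (all_or_none (fun P => 0 <= sg P i) _ Pi) => //; last by rewrite Pi0.
    by move=> P' Q' P'S Q'S /stepi[].
  have [//|/eqP Pi_neq0] := sg P i =P 0.
  have : 0 < sg Pi i; last by rewrite Pi0.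
  apply: (all_or_none (fun P => 0 < sg P i) _ P) => //; last by sgn.
  by move=> P' Q' P'S Q'S /stepi[].
have omS P : P \in S -> sg P o = 0 /\ sg P m = 0.
  by move=> PS; split; apply: end0; rewrite // !inE eqxx ?orbT.
have /and3P[P0M P0v P0a] := sepS P0 P0S; have [P0o P0m] := omS P0 P0S.
have vo : v != o by apply: (@sg_neq _ P0); sgn.
have vm : v != m by apply: (@sg_neq _ P0); sgn.
have ao : a != o by apply: (@sg_neq _ P0); sgn.
have am : a != m by apply: (@sg_neq _ P0); sgn.
have va : v != a by split_uniq vab.
have [|A0 [A0M A0v A0o A0m A0a]] := @cocircuit_through v o m a; first by solve_uniq.
(* The termination measure: the elements crossed on the line [om] between its point [A0] on [v] and
   [P]. *)
pose crossed P := [set f | (sg P f != 0) && (sg P f == - sg A0 f)].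
have [P PS Pmin] := arg_minnP (fun P => #|crossed P|) P0S.
have [Q QS [x [y [A [e [xy]]]]]] := stepS P PS.
case/and5P=> AM /eqP Av /eqP Ax /eqP Ay Aa [Px Py Qx Qy] [PAe Pe Qe] Qc.
have xe : x != e by apply: (@sg_neq _ P); sgn.
have ye : y != e by apply: (@sg_neq _ P); sgn.
have /and3P[QM _ _] := sepS Q QS.
have uxye : uniq [:: x; y; e] by solve_uniq.
(* [P] and [Q] share only the zeros [x] and [y]; hence these are [o] and [m], and the move runs
   along the line [om]. *)
have onA i : sg P i = 0 -> sg Q i = 0 -> sg A i = 0.
  move=> Pi Qi; have [||] := vanish3 QM uxye Qx Qy Qe Qi => iE; subst i => //.
  by rewrite Pi eqxx in Pe.
have [Po Pm] := omS P PS; have [Qo Qm] := omS Q QS.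
have uvom : uniq [:: v; o; m] by solve_uniq.
have AE : A = A0.
  by apply: (cocircuit_eq AM A0M uvom Av (onA o Po Qo) (onA m Pm Qm) A0v A0o A0m Aa A0a).
have := Pmin Q QS; rewrite leqNgt => /negP[]; apply/proper_card/properP; split.
  by apply/subsetP=> f; rewrite !inE -AE; case: (Qc f); sgn.
by exists e; rewrite !inE -AE; sgn.
Qed.

Lemma unblocked_vertex P0 : separates P0 ->
  exists2 P, separates P & ~~ blocked P.
Proof.
move=> sepP0; have [/exists_inP[P]|] :=
  boolP [exists P in separates, ~~ blocked P]; first by exists P.
rewrite negb_exists_in => /forall_inP all_blocked.
have : P0 \in [set P | separates P] by rewrite inE.
rewrite (@closed_under_step_empty [set P | separates P]) ?inE //.
  by move=> P; rewrite inE.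
move=> P; rewrite inE => sepP; have := all_blocked P sepP; rewrite negbK.
by case/(blocked_step sepP) => Q sepQ QP; exists Q; rewrite ?inE.
Qed.

End EdgeSweep.

(** Take a facet [vab] and two further elements [d], [e]. If neither [bde] nor [ade] separates the
    two remaining facet elements, eliminating [v] between them yields the plane [vde] with [a] and
    [b] on opposite sides. *)
Lemma separating_edge : (4 < #|E|)%N -> exists v a b K P,
  [/\ uniq [:: v; a; b], K \in cocircuits M,
      [/\ sg K v = 0, sg K a = 0, sg K b = 0 & forall f, 0 <= sg K f] &
      separates v a P].
Proof.
move=> E5; have /card_gt0P[e0 _] : (0 < #|E|)%N by exact: leq_trans E5.
have [K [KM _ K0]] := polytope e0.
have [v [a [b [u Kv Ka Kb]]]] := three_zeros KM.
have [d [e u5]] : exists d e, uniq [:: v; a; b; d; e].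
  have : (1 < #|[set~ v] :\ a :\ b|)%N.
    have := cardsD1 a [set~ v]; have := cardsD1 b ([set~ v] :\ a).
    by rewrite cardsC1; lia.
  case/card_gt1P=> d [e [+ + de]]; rewrite !inE => /and3P[db da dv] /and3P[eb ea ev].
  by exists d, e; split_uniq u; solve_uniq.
split_uniq u5.
have [|P [PM Pb Pd Pe Pv]] := @cocircuit_through b d e v; first by solve_uniq.
have [|Q [QM Qa Qd Qe Qv]] := @cocircuit_through a d e v; first by solve_uniq.
have Pa : sg P a != 0 by apply: (@cocircuit_neq0 P b d e) => //; solve_uniq.
have Qb : sg Q b != 0 by apply: (@cocircuit_neq0 Q a d e) => //; solve_uniq.
have [Pa0|Pa0] := ltP (sg P a) 0.
  exists v, a, b, K, (- P); split=> //.
  by rewrite /separates opp_cocircuit // !sgN; sgn.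
have [Qb0|Qb0] := ltP (sg Q b) 0.
  exists v, b, a, K, (- Q); split=> //; first by solve_uniq.
  by rewrite /separates opp_cocircuit // !sgN; sgn.
have [|Z [ZM Zv Zc]] := eliminateN PM QM _ Pv Qv.
  by move=> PQ; move: Qb; rewrite -PQ; sgn.
have [Zd Ze] : sg Z d = 0 /\ sg Z e = 0.
  by split; [case: (Zc d)|case: (Zc e)]; sgn.
have Za : sg Z a != 0 by apply: (@cocircuit_neq0 Z d e v) => //; solve_uniq.
have Zb : sg Z b != 0 by apply: (@cocircuit_neq0 Z d e v) => //; solve_uniq.
exists b, a, v, K, Z; split=> //; first by solve_uniq.
by rewrite /separates ZM; case: (Zc a); case: (Zc b); sgn.
Qed.

(* [B] spans a simplicial region whose side of every element is given by [s]. *)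
Definition simplex_region N (B : seq E) (s : sign_vector E) :=
  [/\ uniq B, size B = 4%N, forall f, sg s f != 0 &
  forall b, b \in B -> exists C, [/\ C \in cocircuits N,
    forall c, c \in B -> c != b -> sg C c = 0 &
    forall f, (f \notin B) || (f == b) -> C f = s f]].

(** The region is bounded by [v] and the three zeros of [P]. Its corners are [P] and the points [A],
    [B], [C] where the lines of [P] meet [v]; as [P] is not blocked, these agree on all other
    elements. *)
Lemma unblocked_simplex v a P : v != a -> separates v a P ->
  ~~ blocked v a P -> exists B s, simplex_region M B s.
Proof.
move=> va /and3P[PM Pv Pa] unblocked.
have [x [y [z [u Px Py Pz]]]] := three_zeros PM; split_uniq u.
have PA A p q e : initial v a A p q -> p != q -> sg P p = 0 -> sg P q = 0 ->
    sg P e != 0 -> sg A e != 0 -> A e = P e.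
  move=> Ai pq Pp Pq Pe Ae.
  suff: sg P e != - sg A e.
    rewrite /sg; move: Pe Ae; rewrite !sg_eq0.
    by case: (sign_cases (P e)) => ->; case: (sign_cases (A e)) => ->.
  apply: contra unblocked => PAe.
  apply/existsP; exists p; apply/existsP; exists q.
  apply/existsP; exists A; apply/existsP; exists e.
  by rewrite pq Ai Pp Pq Pe PAe.
have xv : x != v by apply: (@sg_neq _ P); sgn.
have yv : y != v by apply: (@sg_neq _ P); sgn.
have zv : z != v by apply: (@sg_neq _ P); sgn.
have xa : x != a by apply: (@sg_neq _ P); sgn.
have ya : y != a by apply: (@sg_neq _ P); sgn.
have za : z != a by apply: (@sg_neq _ P); sgn.
have [|A [AM Av Ay Az Aa]] := @cocircuit_through v y z a; first by solve_uniq.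
have [|B [BM Bv Bx Bz Ba]] := @cocircuit_through v x z a; first by solve_uniq.
have [|C [CM Cv Cx Cy Ca]] := @cocircuit_through v x y a; first by solve_uniq.
have [Ai Bi Ci] : [/\ initial v a A y z, initial v a B x z & initial v a C x y].
  by split; apply/and5P; split=> //; apply/eqP.
(* At each of [x], [y], [z] the sign is that of the only corner not lying on that element. *)
pose s : sign_vector E := [ffun f => if f == x then A f else if f == y then B f
  else if f == z then C f else P f].
have sE f : s f = if f == x then A f else if f == y then B f
  else if f == z then C f else P f by rewrite ffunE.
have Ax : sg A x != 0 by apply: (@cocircuit_neq0 A v y z) => //; solve_uniq.
have By : sg B y != 0 by apply: (@cocircuit_neq0 B v x z) => //; solve_uniq.
have Cz : sg C z != 0 by apply: (@cocircuit_neq0 C v x y) => //; solve_uniq.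
have Pneq0 f : f != x -> f != y -> f != z -> sg P f != 0.
  by move=> fx fy fz; apply: (@cocircuit_neq0 P x y z) => //; solve_uniq.
have ABC f : f \notin [:: x; y; z; v] -> [/\ A f = P f, B f = P f & C f = P f].
  rewrite !inE !negb_or => /and4P[fx fy fz fv]; have Pf := Pneq0 f fx fy fz.
  split; [apply: (PA A y z)|apply: (PA B x z)|apply: (PA C x y)] => //.
  - by apply: (@cocircuit_neq0 A v y z) => //; solve_uniq.
  - by apply: (@cocircuit_neq0 B v x z) => //; solve_uniq.
  - by apply: (@cocircuit_neq0 C v x y) => //; solve_uniq.
exists [:: x; y; z; v], s; split=> //; first by solve_uniq.
  move=> f; rewrite sg_eq0 sE; case: (f =P x) => [->|/eqP fx]; first by rewrite -sg_eq0.
  case: (f =P y) => [->|/eqP fy]; first by rewrite -sg_eq0.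
  case: (f =P z) => [->|/eqP fz]; first by rewrite -sg_eq0.
  by rewrite -sg_eq0 Pneq0.
have out f : f \notin [:: x; y; z; v] -> s f = P f.
  by rewrite sE !inE !negb_or => /and4P[/negbTE-> /negbTE-> /negbTE-> _].
have yx : y != x by rewrite eq_sym.
have zx : z != x by rewrite eq_sym.
have zy : z != y by rewrite eq_sym.
have vx : v != x by rewrite eq_sym.
have vy : v != y by rewrite eq_sym.
have vz : v != z by rewrite eq_sym.
move=> b; rewrite !inE => /or4P[]/eqP->; [exists A|exists B|exists C|exists P].
- split=> // [c|f]; first by rewrite !inE => /or4P[]/eqP->; rewrite ?eqxx.
  case/orP=> [fB|/eqP->]; last by rewrite sE eqxx.
  by rewrite out //; case: (ABC f fB).
- split=> // [c|f]; first by rewrite !inE => /or4P[]/eqP->; rewrite ?eqxx.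
  case/orP=> [fB|/eqP->]; last by rewrite sE (negbTE yx) eqxx.
  by rewrite out //; case: (ABC f fB).
- split=> // [c|f]; first by rewrite !inE => /or4P[]/eqP->; rewrite ?eqxx.
  case/orP=> [fB|/eqP->]; last by rewrite sE (negbTE zx) (negbTE zy) eqxx.
  by rewrite out //; case: (ABC f fB).
- split=> // [c|f]; first by rewrite !inE => /or4P[]/eqP->; rewrite ?eqxx.
  case/orP=> [fB|/eqP->]; last by rewrite sE (negbTE vx) (negbTE vy) (negbTE vz).
  by rewrite out.
Qed.

(** [separating_edge] needs a fifth element. With four, [B] is all of [E] and each corner is
    constrained only at its own [b], so any signs will do. *)
Lemma simplex_region_exists : (3 < #|E|)%N -> exists B s, simplex_region M B s.
Proof.
rewrite leq_eqVlt => /orP[/eqP E4|/separating_edge[v [a [b [K [P]]]]]]; last first.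
  case=> u KM [Kv Ka Kb K0] sepP.
  have [Q sepQ unblocked] := unblocked_vertex u KM Kv Ka Kb K0 sepP.
  by apply: unblocked_simplex sepQ unblocked; split_uniq u.
exists (enum E), [ffun => 1]; split; rewrite ?enum_uniq -?cardE //.
  by move=> f; rewrite sg_eq0 ffunE.
move=> b _; have : #|[set~ b]| = 3%N by rewrite cardsC1 -E4.
have := enum_uniq [set~ b]; have mem t : (t \in enum [set~ b]) = (t != b).
  by rewrite mem_enum !inE.
rewrite cardE; case: (enum _) mem => [|x [|y [|z []]]] // mem u _.
have [|C [CM Cx Cy Cz]] := @cocircuit_through x y z b.
  rewrite (cat_uniq [:: x; y; z]) u /= orbF andbT mem eqxx //.
rewrite sg_gt0 => /eqP Cb; exists C; split=> // [c _|f].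
  by rewrite -mem !inE => /or3P[]/eqP->.
by rewrite mem_enum => /eqP->; rewrite ffunE.
Qed.

End Polytope.

(** * Ranks, faces and simplices *)

Lemma card_ge4 K : K \in cocircuits M -> (3 < #|E|)%N.
Proof.
move=> KM; have := max_card (mem (zero_part K)); rewrite card_zero_part //.
rewrite leq_eqVlt => /orP[/eqP full|//]; have K0 : K = 0.
  apply/ffunP=> e; rewrite ffunE; apply/eqP.
  have : zero_part K = [set: E] by apply/eqP; rewrite eqEcard subsetT cardsT -full card_zero_part.
  by move/setP/(_ e); rewrite !inE.
by move: (cocircuit0 M); rewrite -K0 KM.
Qed.

Hypothesis E4 : (3 < #|E|)%N.

Lemma independentE (I : {set E}) : matroid_independent M I = (#|I| <= 4)%N.
Proof.
apply/forall_inP/idP => [indep|I4 e eI].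
  rewrite leqNgt; apply/negP=> I5.
  have /card_gt0P[e eI] : (0 < #|I|)%N by exact: leq_trans I5.
  (* No cocircuit vanishes on four elements, so the closure is an empty intersection, that is, all
     of [E]. *)
  have /negP[] := indep e eI; apply/bigcapP=> X /andP[XM /subset_leq_card].
  by have := cardsD1 e I; rewrite (card_zero_part XM) eI; lia.
have [||H [IH He H3]] := @subset_of_card E (I :\ e) [set~ e] 3.
- by apply/subsetP=> x; rewrite !inE => /andP[].
- by have := cardsD1 e I; rewrite eI cardsC1; lia.
have : H \in [set zero_part X | X in cocircuits M] by rewrite uniform4 inE H3.
case/imsetP=> X XM HE; apply/negP=> /bigcapP/(_ X); rewrite XM -HE IH.
by move=> /(_ isT) eH; move/subsetP/(_ _ eH): He; rewrite !inE eqxx.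
Qed.

Lemma matroid_rankE (F : {set E}) : matroid_rank M F = minn #|F| 4.
Proof.
apply/eqP; rewrite eqn_leq; apply/andP; split.
  apply/bigmax_leqP=> I /andP[IF]; rewrite independentE leq_min => ->.
  by rewrite andbT subset_leq_card.
have [||I [_ IF cI]] := @subset_of_card E set0 F (minn #|F| 4).
- exact: sub0set.
- by rewrite cards0 geq_minl.
by rewrite -cI leq_bigmax_cond // independentE cI IF geq_minr.
Qed.

Definition nonneg X := [forall f, 0 <= sg X f].

(** Composition intersects zero sets, so faces arise as intersections of facets. *)
Lemma nonneg_covector (s : seq (sign_vector E)) : {subset s <= cocircuits M} ->
  (forall C, C \in s -> nonneg C) ->
  exists X, [/\ covector M X, nonneg X &
    forall f, X f = 0 <-> forall C, C \in s -> sg C f = 0].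
Proof.
move=> sM s0; exists (foldr (@sv_comp E) 0 s).
split; first by apply/covectorP; exists s.
  elim: s s0 {sM} => [|C s IHs] s0 /=; first by apply/forallP=> f; rewrite /sg ffunE.
  apply/forallP=> f; rewrite /sg ffunE; case: (C f =P 0) => _ /=.
    have /forallP := IHs (fun D Ds => s0 D (@mem_behead _ (C :: s) D Ds)).
    exact.
  by have /forallP/(_ f) := s0 C (mem_head _ _).
move=> f; elim: s {sM s0} => [|C s IHs] /=; first by rewrite ffunE.
rewrite ffunE; case: (C f =P 0) => [Cf|Cf]; last first.
  by split=> [//|/(_ C (mem_head _ _))/eqP]; rewrite sg_eq0 => /eqP.
rewrite IHs; split=> H D.
  by rewrite inE => /predU1P[->|/H//]; apply/eqP; rewrite sg_eq0 Cf.
by move=> Ds; apply: H; rewrite inE Ds orbT.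
Qed.

Lemma zero_part0 : zero_part (0 : sign_vector E) = [set: E].
Proof. by apply/setP=> e; rewrite !inE ffunE. Qed.

(** Take the first factor of a composition: the composition agrees with it wherever it is
    nonzero. *)
Lemma covector_cocircuit X : covector M X -> nonneg X -> X != 0 ->
  exists C, [/\ C \in cocircuits M, nonneg C & zero_part X \subset zero_part C].
Proof.
move=> /covectorP[[|C s] sM ->] X0; first by rewrite eqxx.
move=> _; exists C; split; first exact: sM (mem_head _ _).
  apply/forallP=> f; have /forallP/(_ f) := X0; rewrite /sg /= ffunE.
  by case: (sign_cases (C f)) => ->.
apply/subsetP=> f; rewrite !inE /= ffunE.
by case: (sign_cases (C f)) => ->.
Qed.

Lemma nonnegE X : nonneg X = (pos_part X == ~: zero_part X).
Proof.
apply/forallP/eqP => [X0|/setP XE f].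
  apply/setP=> f; have := X0 f; rewrite !inE -sg_gt0 -sg_eq0; sgn.
by have := XE f; rewrite !inE -sg_gt0 -sg_eq0; sgn.
Qed.

Lemma faceE (F : {set E}) : reflect
  (exists X, [/\ covector M X, nonneg X & zero_part X = F]) (face M F).
Proof.
apply: (iffP existsP) => [[X /and3P[cX /eqP <- /eqP pX]]|[X [cX + <-]]].
  by exists X; rewrite nonnegE pX.
by rewrite nonnegE => pX; exists X; rewrite cX eqxx.
Qed.

Lemma facetP (F : {set E}) : om_rank M = 4%N -> reflect
  (exists K, [/\ K \in cocircuits M, nonneg K & zero_part K = F]) (facet M F).
Proof.
rewrite /facet matroid_rankE => ->.
apply: (iffP andP) => [[/faceE[X [cX X0 XF]] F3]|[K [KM K0 KF]]].
  have {}F3 : #|F| = 3%N by move: F3; rewrite eqSS; lia.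
  have [|C [CM C0 XC]] := covector_cocircuit cX X0.
    by apply/eqP=> Xz; have := zero_part0; rewrite -Xz XF => FT; move: E4;
      rewrite -cardsT -FT F3.
  exists C; split=> //; apply/esym/eqP; rewrite -XF eqEcard XC XF F3.
  by rewrite card_zero_part.
split; last by rewrite -KF card_zero_part.
have [||X [cX X0 Xz]] := @nonneg_covector [:: K].
- by move=> C; rewrite inE => /eqP->.
- by move=> C; rewrite inE => /eqP->.
apply/faceE; exists X; split=> //; rewrite -KF; apply/setP=> f.
rewrite !inE -[in RHS]sg_eq0; apply/eqP/eqP => [/Xz|Kf]; first by apply; rewrite mem_head.
by apply/Xz=> C; rewrite inE => /eqP->.
Qed.

Lemma pivot_facet K p q z : K \in cocircuits M -> nonneg K ->
  uniq [:: p; q; z] -> sg K p = 0 -> sg K q = 0 -> sg K z = 0 ->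
  exists D, [/\ D \in cocircuits M, nonneg D, sg D p = 0, sg D q = 0 & 0 < sg D z].
Proof.
move=> KM /forallP K0 u Kp Kq Kz.
(* With [L] the complement of the axis, [D] is nonnegative everywhere, as it vanishes on the
   axis. *)
have [|||w [D [_ DM [Dp Dq _] Dz D0]]] :=
  pivot KM u Kp Kq Kz (fun f (_ : f \in ~: [set p; q]) => K0 f).
- by rewrite !inE eqxx.
- by rewrite !inE eqxx orbT.
- have : (0 < #|[set~ p] :\ q :\ z|)%N.
    have := cardsD1 q [set~ p]; have := cardsD1 z ([set~ p] :\ q).
    by rewrite cardsC1; lia.
  case/card_gt0P=> w; rewrite !inE => /and3P[wz wq wp].
  by exists w; rewrite // !inE negb_or wp.
exists D; split=> //; apply/forallP=> f; have := D0 f; rewrite !inE negb_or.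
by case: eqP => [->|_]; [rewrite Dp|case: eqP => [->|_]; [rewrite Dq|apply]].
Qed.

(** For the converse, compose all facets through [e]. Any other element [f] of the facet [K] drops
    out: pivoting [K] about [e] and its third element gives a facet through [e] that avoids [f]. *)
Lemma extreme_pointP (F : {set E}) : reflect
  (exists2 e, F = [set e] & exists K, [/\ K \in cocircuits M, nonneg K & sg K e = 0])
  (extreme_point M F).
Proof.
rewrite /extreme_point matroid_rankE.
apply: (iffP andP) => [[/faceE[X [cX X0 XF]] F1]|[e -> [K [KM K0 Ke]]]].
  have /cards1P[e Fe] : #|F| == 1%N by lia.
  exists e => //; have [|C [CM C0 XC]] := covector_cocircuit cX X0.
    by apply/eqP=> Xz; have := zero_part0; rewrite -Xz XF => FT; move: E4;
      rewrite -cardsT -FT Fe cards1.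
  exists C; split=> //; apply/eqP; rewrite sg_eq0.
  have : e \in zero_part C by rewrite (subsetP XC) // XF Fe inE.
  by rewrite inE.
split; last by rewrite cards1.
pose s := enum [set C in cocircuits M | nonneg C && (sg C e == 0)].
have sP C : (C \in s) = [&& C \in cocircuits M, nonneg C & sg C e == 0].
  by rewrite mem_enum inE.
have [||X [cX X0 Xz]] := @nonneg_covector s.
- by move=> C; rewrite sP => /and3P[].
- by move=> C; rewrite sP => /and3P[].
apply/faceE; exists X; split=> //; apply/setP=> f; rewrite !inE.
apply/eqP/eqP => [/Xz all0|->]; last by apply/Xz=> C; rewrite sP => /and3P[_ _ /eqP].
apply/eqP; apply: contraT => fe.
have Kf : sg K f = 0 by apply: all0; rewrite sP KM K0 Ke.
have [t [u Kt]] : exists t, uniq [:: e; t; f] /\ sg K t = 0.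
  have : (0 < #|zero_part K :\ e :\ f|)%N.
    have := cardsD1 e (zero_part K); have := cardsD1 f (zero_part K :\ e).
    by rewrite (card_zero_part KM); lia.
  case/card_gt0P=> t; rewrite !inE -sg_eq0 => /and3P[tf te /eqP Kt].
  by exists t; split=> //; solve_uniq.
have [D [DM D0 De _ Df]] := pivot_facet KM K0 u Ke Kt Kf.
by have := all0 D; rewrite sP DM D0 De => /(_ isT) Df0; rewrite Df0 in Df.
Qed.

(** The corners are nonnegative and no element lies on all four, which gives acyclicity. An element
    outside [B] is interior, hence on no facet; one in [B] lies on the corner of any other member of
    [B]. *)
Lemma simplex_extreme_points (B : seq E) : simplex_region M B [ffun => 1] ->
  acyclic M /\ #|[set F | extreme_point M F]| = 4%N.
Proof.
case=> uB sB _ simB.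
have facet_of b : b \in B -> exists C, [/\ C \in cocircuits M, nonneg C,
    forall c, c \in B -> c != b -> sg C c = 0 &
    forall f, (f \notin B) || (f == b) -> 0 < sg C f].
  move=> bB; have [C [CM C0 C1]] := simB b bB.
  have Cpos f : (f \notin B) || (f == b) -> 0 < sg C f.
    by move=> /C1; rewrite ffunE sg_gt0 => ->.
  exists C; split=> //; apply/forallP=> f.
  have [fB|/norP[]] := boolP ((f \notin B) || (f == b)); first exact/ltW/Cpos.
  by rewrite negbK => fB /(C0 f fB) ->.
split.
  pose s := enum [set C in cocircuits M | nonneg C].
  have sP C : (C \in s) = (C \in cocircuits M) && nonneg C by rewrite mem_enum inE.
  have [||X [cX /forallP X0 Xz]] := @nonneg_covector s.
  - by move=> C; rewrite sP => /andP[].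
  - by move=> C; rewrite sP => /andP[].
  suff -> : acyclic M = covector M X by [].
  congr covector; apply/ffunP=> f; rewrite ffunE; apply/esym/eqP.
  rewrite -sg_gt0 lt_neqAle X0 andbT eq_sym sg_eq0; apply/eqP=> /Xz all0.
  have [b [bB bf]] : exists b, b \in B /\ ((f \notin B) || (f == b)).
    case: (boolP (f \in B)) => [fB|_]; first by exists f; rewrite eqxx.
    by case: B sB {uB simB facet_of} => // b *; exists b; rewrite mem_head.
  have [C [CM C0 _ /(_ f bf)]] := facet_of b bB.
  by rewrite all0 // sP CM.
rewrite -sB -(card_uniqP uB) -(card_imset _ (@set1_inj E)).
congr #|pred_of_set _|; apply/setP=> F; rewrite inE.
apply/extreme_pointP/imsetP => [[e -> [K [KM K0 Ke]]]|[e eB ->]]; exists e => //.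
  apply: contraT => eB; suff : 0 < sg K e by rewrite Ke.
  apply: simplex_interior uB sB _ KM _; last by move=> b _; have /forallP := K0; apply.
  move=> b bB; have [C [CM _ C0 Cpos]] := facet_of b bB.
  exists C; split=> //; try by apply: Cpos; rewrite ?eB ?eqxx ?orbT.
  by move=> c cB /eqP; apply: C0.
have [c cB ec] : exists2 c, c \in B & e != c.
  case: B uB sB {simB facet_of} eB => [|b [|c B]] //= /andP[+ _] _ _.
  rewrite inE negb_or => /andP[bc _]; have [->|eb] := eqVneq e b.
    by exists c; rewrite // !inE eqxx orbT.
  by exists b; rewrite // mem_head.
have [C [CM C0 Cz _]] := facet_of c cB.
by exists C; split=> //; apply: Cz.
Qed.

End Uniform4.

(* Applied to the set [Fs] of facets; [cover Fs] is the set of extreme points. *)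
Lemma card_cover_pivot (T : finType) (Fs : {set {set T}}) :
  (forall P, P \in Fs -> #|P| = 3%N) -> Fs != set0 ->
  (forall P t, P \in Fs -> t \in P ->
     exists2 Q, Q \in Fs & (P :\ t \subset Q) && (t \notin Q)) ->
  #|cover Fs| = 4%N <-> #|Fs| = 4%N.
Proof.
move=> Fs3 /set0Pn[P PFs] pivotFs; split=> [V4|Fs4].
  (* A triple [A] other than [P] misses some [t] in [P]; then [A] and the pivot of [P] at [t] both
     equal the cover minus [t]. *)
  have FsE : Fs = [set A : {set T} | A \subset cover Fs & #|A| == 3%N].
    apply/setP=> A; rewrite inE.
    apply/idP/andP=> [AFs|[AV /eqP A3]]; first by rewrite (bigcup_sup A) // Fs3.
    have [->//|AP] := eqVneq A P.
    have /subsetPn[t tP tA] : ~~ (P \subset A).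
      by apply: contra AP => PA; rewrite eq_sym eqEcard PA A3 Fs3.
    have [Q QFs /andP[_ tQ]] := pivotFs P t PFs tP.
    have tV : t \in cover Fs by apply/bigcupP; exists P.
    have V't : #|cover Fs :\ t| = 3%N by have := cardsD1 t (cover Fs); rewrite tV V4 add1n => -[<-].
    have eqV't (H : {set T}) : H \subset cover Fs -> t \notin H -> #|H| = 3%N ->
        H = cover Fs :\ t.
      move=> HV tH H3; apply/eqP; rewrite eqEcard V't H3 leqnn andbT.
      by rewrite subsetD1 HV tH.
    by rewrite (eqV't A) // -(eqV't Q) // ?Fs3 // (bigcup_sup Q).
  by rewrite FsE cards_draws V4.
(* The default [P] never occurs for [t] in [P]. *)
pose opposite t := odflt P [pick Q in Fs | (P :\ t \subset Q) && (t \notin Q)].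
have oppP t : t \in P ->
    [/\ opposite t \in Fs, P :\ t \subset opposite t & t \notin opposite t].
  move=> tP; rewrite /opposite; case: pickP => [Q /and3P[]//|noQ].
  by have [Q QFs Qt] := pivotFs P t PFs tP; have := noQ Q; rewrite /= QFs Qt.
have opp_mem t t' : t \in P -> t' \in P -> t != t' -> t \in opposite t'.
  move=> tP t'P tt'; have [_ /subsetP sub _] := oppP t' t'P.
  by apply: sub; rewrite !inE tt'.
have FsE : Fs = P |: [set opposite t | t in P].
  apply/esym/eqP; rewrite eqEcard Fs4 cardsU1 card_in_imset ?Fs3 //.
    rewrite subUset sub1set PFs /= (_ : _ \notin _) ?andbT //; last first.
      apply/imsetP=> -[t tP PE]; have [_ _ /negP[]] := oppP t tP.
      by rewrite -PE.
    by apply/subsetP=> Q /imsetP[t tP ->]; have [] := oppP t tP.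
  move=> t t' tP t'P tt'; apply/eqP; apply: contraT => neq.
  by have [_ _ /negP[]] := oppP t tP; rewrite tt' opp_mem.
have /card_gt0P[t0 t0P] : (0 < #|P|)%N by rewrite Fs3.
have [Q0Fs _ t0Q] := oppP t0 t0P.
have /subsetPn[w wQ wP] : ~~ (opposite t0 \subset P).
  apply: contra t0Q => QP; suff -> : opposite t0 = P by [].
  by apply/eqP; rewrite eqEcard QP !Fs3.
(* Pivoting [opposite t0] at [t] keeps [w] and drops [t]; among the four members of [Fs] only
   [opposite t] qualifies. *)
have w_opp t : t \in P -> w \in opposite t.
  move=> tP; have [->//|tt0] := eqVneq t t0.
  have [R RFs /andP[/subsetP subR tR]] := pivotFs _ t Q0Fs (opp_mem _ _ tP t0P tt0).
  have wR : w \in R.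
    by apply: subR; rewrite !inE wQ andbT; apply: contraNneq wP => ->.
  move: RFs; rewrite FsE => /setU1P[RP|/imsetP[t' t'P RE]].
    by rewrite RP (negbTE wP) in wR.
  have [->|tt'] := eqVneq t t'; first by rewrite -RE.
  by rewrite RE opp_mem in tR.
suff -> : cover Fs = w |: P by rewrite cardsU1 wP Fs3.
apply/setP=> f; apply/bigcupP/setU1P => [[Q + fQ]|[->|fP]]; last by exists P.
  rewrite FsE => /setU1P[QP|/imsetP[t tP QE]]; first by right; rewrite -QP.
  have [oFs sub _] := oppP t tP.
  have oE : w |: (P :\ t) = opposite t.
    apply/eqP; rewrite eqEcard subUset sub sub1set w_opp // Fs3 // cardsU1.
    rewrite !inE (negbTE wP) andbF /=.
    by have := cardsD1 t P; rewrite tP Fs3 // add1n => -[<-].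
  move: fQ; rewrite QE -oE => /setU1P[->|]; first by left.
  by rewrite inE => /andP[_ fP]; right.
by exists (opposite t0).
Qed.

(** * Reorientation *)

Section Reorient.
Variables (E : finType) (F : {set E}).
Implicit Types (M N : oriented_matroid E) (X Y : sign_vector E).

Lemma sv_reorient_comp X Y :
  sv_reorient F (sv_comp X Y) = sv_comp (sv_reorient F X) (sv_reorient F Y).
Proof.
apply/ffunP=> e; rewrite !ffunE; case: (e \in F); rewrite ?oppr_eq0 //.
by case: (X e != 0).
Qed.

Lemma sv_ge_reorient X Y :
  sv_ge (sv_reorient F X) (sv_reorient F Y) = sv_ge X Y.
Proof.
apply: eq_forallb => e; rewrite !ffunE; case: (e \in F) => //.
by rewrite eqr_opp oppr_eq0.
Qed.

(** Reorientation commutes with composition and preserves the order, so chains of covectors go to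
    chains. Used in both directions, this gives equality. *)
Lemma leq_om_rank_reorient M N :
  {homo sv_reorient F : X / X \in cocircuits M >-> X \in cocircuits N} ->
  (om_rank M <= om_rank N)%N.
Proof.
move=> MN; have r0 : sv_reorient F 0 = 0.
  by apply/ffunP=> e; rewrite !ffunE oppr0 if_same.
have cov X : covector M X -> covector N (sv_reorient F X).
  case/covectorP=> s sM ->; apply/covectorP; exists (map (sv_reorient F) s).
    by move=> _ /mapP[C /sM CM ->]; apply: MN.
  by elim: s {sM} => //= C s <-; rewrite sv_reorient_comp.
have rI : injective (sv_reorient F) := inv_inj (@sv_reorientK E F).
apply/bigmax_leqP=> S /andP[/forall_inP S0 /forall_inP Sc].
rewrite -(card_imset _ rI); apply: leq_bigmax_cond; apply/andP; split.
  apply/forall_inP=> _ /imsetP[X /S0/andP[cX X0] ->].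
  by rewrite cov //= -r0 (inj_eq rI).
apply/forall_inP=> _ /imsetP[X XS ->]; apply/forall_inP=> _ /imsetP[Y YS ->].
by rewrite !sv_ge_reorient; have /forall_inP := Sc X XS; apply.
Qed.

Lemma om_rank_reorientation M : om_rank (reorientation F M) = om_rank M.
Proof.
apply/eqP; rewrite eqn_leq; apply/andP; split; apply: leq_om_rank_reorient => X.
  by rewrite /= mem_reorient_cocircuits.
by rewrite /= mem_reorient_cocircuits sv_reorientK.
Qed.

Lemma zero_parts_reorientation M :
  [set zero_part X | X in cocircuits (reorientation F M)] =
  [set zero_part X | X in cocircuits M].
Proof.
rewrite /= /reorient_cocircuits -imset_comp.
by apply: eq_imset => X; apply: zero_part_reorient.
Qed.

End Reorient.

(** Reorienting where [s] is negative makes [s] all-positive. *)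
Lemma simplex_region_reorientation (E : finType) (M : oriented_matroid E) B s :
  simplex_region M B s ->
  simplex_region (reorientation [set f | s f == -1] M) B [ffun => 1].
Proof.
case=> uB sB s0 simB; split=> // [f|b /simB[C [CM C0 Cs]]].
  by rewrite sg_eq0 ffunE.
exists (sv_reorient [set f | s f == -1] C).
split; first by rewrite /= mem_reorient_cocircuits sv_reorientK.
  move=> c cB cb; have /eqP := C0 c cB cb; rewrite sg_eq0 => /eqP Cc.
  by apply/eqP; rewrite sg_eq0 ffunE Cc oppr0 if_same.
move=> f /Cs Cf; rewrite !ffunE inE Cf; move: (s0 f); rewrite sg_eq0.
by case: (sign_cases (s f)) => ->; rewrite ?eqxx ?opprK.
Qed.

(** Extreme points are the elements covered by facets. Acyclicity provides a facet and [pivot_facet]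
    the exchange property for [card_cover_pivot]. *)
Lemma card_extreme_points_facets (E : finType) (M : oriented_matroid E) :
  om_rank M = 4%N ->
  [set zero_part X | X in cocircuits M] = [set A : {set E} | #|A| == 3%N] ->
  (3 < #|E|)%N -> acyclic M ->
  #|[set P | extreme_point M P]| = 4%N <-> #|[set P | facet M P]| = 4%N.
Proof.
move=> rk U E4 acM; have fP F := facetP U E4 F rk.
have -> : [set P | extreme_point M P] =
    [set [set e] | e in cover [set P | facet M P]].
  apply/setP=> P; rewrite inE.
  apply/(extreme_pointP U E4)/imsetP => [[e -> [K [KM K0 Ke]]]|[e /bigcupP[Q]]].
    exists e => //; apply/bigcupP; exists (zero_part K); rewrite inE ?Ke.
      by apply/fP; exists K.
    by rewrite -sg_eq0 Ke.
  rewrite inE => /fP[K [KM K0 <-]]; rewrite inE -sg_eq0 => /eqP Ke ->.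
  by exists e => //; exists K.
rewrite card_imset; last exact: set1_inj; apply: card_cover_pivot.
- by move=> P; rewrite inE => /fP[K [KM _ <-]]; exact: (card_zero_part U KM).
- have [||C [CM C0 _]] := covector_cocircuit acM.
  + by apply/forallP=> f; apply: ltW; rewrite sg_gt0 ffunE.
  + have /card_gt0P[e _] : (0 < #|E|)%N by exact: leq_trans E4.
    by apply/eqP=> /ffunP/(_ e); rewrite !ffunE.
  by apply/set0Pn; exists (zero_part C); rewrite inE; apply/fP; exists C.
move=> P t; rewrite inE => /fP[K [KM K0 <-]]; rewrite inE -sg_eq0 => /eqP Kt.
have [p [q [u Kp Kq]]] : exists p q, [/\ uniq [:: p; q; t], sg K p = 0 & sg K q = 0].
  have : (1 < #|zero_part K :\ t|)%N.
    by have := cardsD1 t (zero_part K); rewrite (card_zero_part U KM); lia.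
  case/card_gt1P=> p [q [+ + pq]]; rewrite !inE -!sg_eq0.
  by move=> /andP[pt /eqP Kp] /andP[qt /eqP Kq]; exists p, q; split=> //; solve_uniq.
have [D [DM D0 Dp Dq Dt]] := pivot_facet U E4 KM K0 u Kp Kq Kt.
exists (zero_part D); first by rewrite inE; apply/fP; exists D.
rewrite (zero_partE U KM u) //; apply/andP; split; last by rewrite inE -sg_eq0; sgn.
apply/subsetP=> c; rewrite !inE -sg_eq0 => /andP[/negbTE->]; rewrite orbF.
by case/orP=> /eqP->; apply/eqP.
Qed.

Local Close Scope ring_scope.

Theorem theorem5p2 (E : finType) (M : oriented_matroid E)
  (M_rank4 : om_rank M = 4)
  (M_uniform : om_uniform M)
  (M_polytope : matroid_polytope M) :
  (exists F : {set E},
     acyclic (reorientation F M) /\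
     #|[set P | extreme_point (reorientation F M) P]| = 4) /\
  (forall F : {set E}, acyclic (reorientation F M) ->
     (#|[set P | extreme_point (reorientation F M) P]| = 4 <->
      #|[set P | facet (reorientation F M) P]| = 4)).
Proof.
have U : [set zero_part X | X in cocircuits M] = [set A : {set E} | #|A| == 3%N].
  by rewrite M_uniform M_rank4; apply/setP=> A; rewrite !inE eqSS.
(* Without cocircuits, 0 would be the only covector and the rank would be 0. *)
have [K KM] : exists K, K \in cocircuits M.
  apply/set0Pn/eqP=> M0; suff : (om_rank M <= 0)%N by rewrite M_rank4.
  apply/bigmax_leqP=> S /andP[/forall_inP S0 _]; rewrite leqn0 cards_eq0.
  apply/eqP/setP=> X; rewrite inE; apply/negP=> /S0/andP[/covectorP[[|C s] sM ->]].
    by rewrite eqxx.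
  by have := sM C (mem_head _ _); rewrite M0 inE.
have E4 := card_ge4 U KM.
split=> [|F acF].
  have polytope e : exists K,
      [/\ K \in cocircuits M, sg K e = 0 & forall f, 0 <= sg K f]%R.
    have /(extreme_pointP U E4)[e' /set1_inj<- [K' [K'M /forallP K'0 K'e]]] := M_polytope e.
    by exists K'.
  have [B [s simB]] := simplex_region_exists U polytope E4.
  exists [set f | s f == -1]%R; apply: simplex_extreme_points E4 _ _.
    by rewrite zero_parts_reorientation.
  exact: simplex_region_reorientation simB.
apply: card_extreme_points_facets => //; first by rewrite om_rank_reorientation.
by rewrite zero_parts_reorientation.
Qed.
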